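(* Let $\{t^i\}$ be a net in $IP(k)$ with $r^i$ the length of $t^i$. If $|j_{r^i}(t^i)|\to\infty$ then $$\lim_{i\to\infty}\ \sup_{\mathcal M\in\mathcal{LAB}} d\bigl(S^{t^i}(x[\mathcal M]),\,x[\mathcal M-\mathbf r(t^i)]\bigr)=0.$$ Furthermore, if $t^i\in IP_+(k)$ for all $i$, then $$\lim_{i\to\infty}\ \sup_{\mathcal M\in\mathcal{LAB}} d\bigl(S^{t^i}(x_+[\mathcal M]),\,x_+[\mathcal M-\mathbf r(t^i)]\bigr)=0.$$
   Context: Write $\mathbb N=\{1,2,\dots\}$. An $\mathbb N$-vector is a function $\mathbf m:\mathbb N\to\{0,1,2,\dots\}$ with finite support; $FIN(\mathbb N)$ is the additive monoid of all $\mathbb N$-vectors, with identity $\mathbf 0$ and the pointwise order. A label is a set $\mathcal M\subset FIN(\mathbb N)$ such that $\mathbf 0\le\mathbf m_1\le\mathbf m\in\mathcal M$ implies $\mathbf m_1\in\mathcal M$; $\mathcal{LAB}$ is the set of all labels (including $\emptyset$). For $\mathbf r\in FIN(\mathbb N)$, $\mathcal M-\mathbf r=\{\mathbf w\in FIN(\mathbb N):\mathbf w+\mathbf r\in\mathcal M\}$, again a label. Fix an odd integer $b\ge5$ and a partition $\{D_\ell:\ell\in\mathbb N\}$ of $\mathbb N$ into infinite sets with $\min D_\ell<\min D_{\ell+1}$. Define $k:\mathbb Z\to\mathbb Z$ by $k(n)=b^{n-1}$ for $n\ge1$, $k(0)=0$, $k(-n)=-k(n)$. $IP(k)$ (resp.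 $IP_+(k)$) is the set of sums of finite subsets of $k(\mathbb Z)$ (resp. of $k(\{0,1,2,\dots\})$). Each $t\in IP(k)$ has a unique expansion $t=k(j_1)+\dots+k(j_r)$ with $j_i=j_i(t)$, $|j_1|>\dots>|j_r|>0$ and length $r=r(t)$ ($r=0$ for $t=0$). Thus for $t\neq0$, $|j_{r}(t)|$ is the smallest nonzero place $n_*(t)$ in the expansion; by convention $n_*(0)=\infty$ plays this role for $t=0$. The length vector $\mathbf r(t)\in FIN(\mathbb N)$ is $\mathbf r(t)_\ell=\#\{i:|j_i|\in D_\ell\}$. For a label $\mathcal M$, $A[\mathcal M]=\{t\in IP(k):\mathbf r(t)\in\mathcal M\}$, $A_+[\mathcal M]=A[\mathcal M]\cap IP_+(k)$, and $x[\mathcal M],x_+[\mathcal M]\in\{0,1\}^{\mathbb Z}$ are the characteristic functions of $A[\mathcal M]$ and $A_+[\mathcal M]$. $S$ is the shift on $\{0,1\}^{\mathbb Z}$, $S(x)_t=x_{t+1}$, and $d(x,y)=\inf\{2^{-N}:N\ge0,\ x_t=y_t\text{ for all }|t|<N\}$ on $\{0,1\}^{\mathbb Z}$. *)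

(* Defs.v *)
From HB Require Import structures.
From mathcomp Require Import all_boot all_order all_algebra.
From mathcomp Require Import finmap.
From mathcomp Require Import all_classical all_reals all_analysis.

Set Implicit Arguments.
Unset Strict Implicit.
Unset Printing Implicit Defensive.

Import Order.TTheory GRing.Theory Num.Theory.
Import numFieldNormedType.Exports.

Local Open Scope classical_set_scope.
Local Open Scope ring_scope.

(* The set {1, 2, ...}; it indexes the cells [D l] and the coordinates of
   the N-vectors. *)
Definition posnat := {n : nat | (0 < n)%N}.

(* N-vectors are kept as bare functions, finiteness of the support being
   the predicate [FIN]. *)
Definition FIN : set (posnat -> nat) :=
  [set m | finite_set [set l | m l != 0%N]].

Definition vadd (m1 m2 : posnat -> nat) : posnat -> nat :=
  fun l => (m1 l + m2 l)%N.

Definition vle (m1 m2 : posnat -> nat) : Prop := forall l, (m1 l <= m2 l)%N.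

Definition label (M : set (posnat -> nat)) : Prop :=
  M `<=` FIN /\ forall m1 m, FIN m1 -> vle m1 m -> M m -> M m1.

Definition LAB : set (set (posnat -> nat)) := [set M | label M].

Definition label_sub (M : set (posnat -> nat)) (r : posnat -> nat) :
    set (posnat -> nat) :=
  [set w | FIN w /\ M (vadd w r)].

Definition is_min (A : set nat) (m : nat) : Prop := A m /\ lbound A m.

Definition admissible_partition (D : posnat -> set nat) : Prop :=
  [/\ partition setT D [set n : nat | (0 < n)%N],
      forall l, infinite_set (D l) &
      forall (l l' : posnat) (m m' : nat), val l' = (val l).+1 ->
        is_min (D l) m -> is_min (D l') m' -> (m < m')%N].

(* [Negz n] is -(n+1), so k(-(n+1)) = - b^n. *)
Definition k (b : nat) (j : int) : int :=
  match j with
  | Posz 0 => 0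
  | Posz n.+1 => b%:Z ^+ n
  | Negz n => - (b%:Z ^+ n)
  end.

(* Sums of the finite subsets of A. *)
Definition finite_sums (A : set int) : set int :=
  [set t | exists2 F : {fset int}, [set` F] `<=` A & t = \sum_(s <- F) s].

Definition IP (b : nat) : set int := finite_sums (range (k b)).

Definition IP_plus (b : nat) : set int :=
  finite_sums (k b @` [set j : int | 0 <= j]).

Definition is_expansion (b : nat) (t : int) (js : seq int) : Prop :=
  [/\ sorted (fun i j : int => (`|j| < `|i|)%N) js,
      all (fun j : int => (0 < `|j|)%N) js &
      t = \sum_(j <- js) k b j].

(* [:: j_1(t); ...; j_r(t)], which is unique for t in IP b (b odd, b >= 5);
   the default value [::] is only reached when t is not in IP b. *)
Definition expansion (b : nat) (t : int) : seq int :=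
  xget [::] [set js | is_expansion b t js].

(* |j_r(t)| for t <> 0, and +oo for t = 0. *)
Definition nstar (R : realType) (b : nat) (t : int) : \bar R :=
  if t == 0 then +oo%E else (absz (last 0 (expansion b t)))%:R%:E.

Definition length_vector (b : nat) (D : posnat -> set nat) (t : int) :
    posnat -> nat :=
  fun l => count (fun j : int => `[< D l `|j|%N >]) (expansion b t).

Definition A_ (b : nat) (D : posnat -> set nat) (M : set (posnat -> nat)) :
    set int :=
  [set t | IP b t /\ M (length_vector b D t)].

Definition A_plus (b : nat) (D : posnat -> set nat) (M : set (posnat -> nat)) :
    set int :=
  A_ b D M `&` IP_plus b.

(* {0,1}^Z is the type int -> bool. *)
Definition char_fun (B : set int) : int -> bool := fun t => `[< B t >].

Definition x_ (b : nat) (D : posnat -> set nat) (M : set (posnat -> nat)) :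
    int -> bool := char_fun (A_ b D M).

Definition x_plus (b : nat) (D : posnat -> set nat) (M : set (posnat -> nat)) :
    int -> bool := char_fun (A_plus b D M).

Definition bshift (u : int -> bool) : int -> bool := fun t => u (t + 1).

Definition bshift_inv (u : int -> bool) : int -> bool := fun t => u (t - 1).

Lemma bshiftK : cancel bshift bshift_inv.
Proof. by move=> u; apply/funext => t; rewrite /bshift /bshift_inv subrK. Qed.

Lemma bshift_invK : cancel bshift_inv bshift.
Proof. by move=> u; apply/funext => t; rewrite /bshift /bshift_inv addrK. Qed.

(* Integer powers S^n of the invertible map S. *)
Definition bshiftz (n : int) (u : int -> bool) : int -> bool :=
  match n with
  | Posz p => iter p bshift u
  | Negz p => iter p.+1 bshift_inv u
  end.

Definition bdist (R : realType) (u v : int -> bool) : R :=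
  inf [set (2 : R) ^- N | N in
        [set N : nat | forall t : int, (`|t| < N)%N -> u t = v t]].

Definition directed_preorder (I : Type) (le : I -> I -> Prop) : Prop :=
  [/\ inhabited I, (forall i, le i i),
      (forall i j l, le i j -> le j l -> le i l) &
      (forall i j, exists l, le i l /\ le j l)].

(* Convergence of a net indexed by (I, le) is convergence along this
   filter. *)
Definition tails (I : Type) (le : I -> I -> Prop) : set_system I :=
  filter_from setT (fun i0 => [set i | le i0 i]).

(* Main.v *)
Require Import Defs.
From HB Require Import structures.
From mathcomp Require Import all_boot all_order all_algebra.
From mathcomp Require Import finmap.
From mathcomp Require Import all_classical all_reals all_analysis.
From mathcomp Require Import zify.

Set Implicit Arguments.
Unset Strict Implicit.
Unset Printing Implicit Defensive.

Import Order.TTheory GRing.Theory Num.Theory.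
Import numFieldNormedType.Exports.

Local Open Scope classical_set_scope.
Local Open Scope ring_scope.

(** Write t in IP(k) as a number in base b with digits -1, 0, 1, a digit at
    place n >= 1 having weight b^(n-1). As b >= 3, the digits at places up to m
    contribute less than b^m / 2 in absolute value ([small_expansion]); so the
    leading term dominates ([large_expansion]) and expansions are unique
    ([is_expansion_uniq]).

    Suppose that all places of t are beyond m and that 2|s| < b^m. If s has an
    expansion, its places are at most m, and juxtaposing the two expansions
    gives that of s + t ([expansion_add]). If it is s + t that has an
    expansion, its part at places at most m is congruent to s modulo b^m and
    both are too small to differ, so this part is an expansion of s
    ([expansion_split]). Thus s + t is in IP(k) if and only if s is, and then
    r(s + t) = r(s) + r(t), so that s + t is in A[M] if and only if s is in
    A[M - r(t)] ([shift_agree]). The points S^t(x[M]) and x[M - r(t)] therefore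
    agree on all s with 2|s| < b^m. This window does not depend on M and grows
    with m, which gives the uniform limit ([sup_bdist_cvg0]). For nonnegative
    places the argument is the same: everything is done for sums of k(j) with j
    in a given set A of integers. *)

(** * Uniqueness and size of expansions *)

(** The relation along which the places of an expansion are sorted. *)
Definition absgt : rel int := fun i j => (`|j| < `|i|)%N.

Lemma absgt_trans : transitive absgt.
Proof. by move=> x y z; rewrite /absgt; lia. Qed.

Lemma kE b (j : int) : k b j = sgz j * b%:Z ^+ (`|j|%N).-1.
Proof. by case: j => [[|n]|n] //=; rewrite ?mul0r ?mul1r ?mulN1r. Qed.

Lemma kN b (j : int) : k b (- j) = - k b j.
Proof. by rewrite !kE sgzN abszN mulNr. Qed.

Lemma k0 b : k b 0 = 0. Proof. by []. Qed.

Lemma normk b (j : int) : (0 < `|j|)%N -> `|k b j| = b%:Z ^+ (`|j|%N).-1.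
Proof.
move=> j0; rewrite kE normrM normrX normr_sgz.
by rewrite -absz_gt0 j0 mul1r.
Qed.

Lemma is_expansion_cons b (j : int) p t :
  is_expansion b t (j :: p) <->
  [/\ (0 < `|j|)%N, all (fun i : int => (`|i| <= (`|j|).-1)%N) p &
      is_expansion b (t - k b j) p].
Proof.
have allE : (0 < `|j|)%N ->
    all (absgt j) p = all (fun i : int => (`|i| <= (`|j|).-1)%N) p.
  by move=> j0; apply: eq_all => i; rewrite /absgt; lia.
rewrite /is_expansion /= (path_sortedE absgt_trans) big_cons; split.
  move=> [/andP[ap sp] /andP[j0 p0] ->]; split=> //; first by rewrite -allE.
  by split=> //; rewrite addrC addKr.
move=> [j0 ap [sp p0 tE]]; split; [|by rewrite j0|by rewrite -tE addrC subrK].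
by rewrite sp allE // ap.
Qed.

Lemma is_expansion_filter b t js (P : pred int) : is_expansion b t js ->
  is_expansion b (\sum_(j <- [seq j <- js | P j]) k b j) [seq j <- js | P j].
Proof.
move=> [sjs js0 _]; split=> //; first exact: (sorted_filter absgt_trans).
by rewrite all_filter; apply: sub_all js0 => j /= ->; rewrite implybT.
Qed.

(** The places up to [m] sum to less than half of b^m: the lower places are
    below half of the leading term, and 3/2 * b^(m-1) <= b^m / 2 because
    b >= 3. *)
Lemma small_expansion b m t js : (2 < b)%N -> is_expansion b t js ->
  all (fun j : int => (`|j| <= m)%N) js -> `|t| *+ 2 < b%:Z ^+ m.
Proof.
move=> hb; elim: js m t => [|j p IH] m t.
  by move=> [_ _ ->] _; rewrite big_nil normr0 mul0rn exprn_gt0 //; lia.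
move=> /is_expansion_cons[j0 pj ep] /= /andP[jm _].
have := IH _ _ ep pj; have := ler_normD (t - k b j) (k b j).
rewrite subrK normk //.
have : b%:Z ^+ (`|j|%N).-1 * 3 <= b%:Z ^+ m.
  apply: (@le_trans _ _ (b%:Z ^+ `|j|%N)).
    by rewrite -[in leRHS](prednK j0) exprSr ler_pM2l ?exprn_gt0; lia.
  by apply: ler_weXn2l => //; lia.
lia.
Qed.

Lemma head_small b t j p : (2 < b)%N -> is_expansion b t (j :: p) ->
  `|t - k b j| *+ 2 < b%:Z ^+ (`|j|%N).-1.
Proof. by move=> hb /is_expansion_cons[j0 pj /small_expansion]; apply. Qed.

(** The leading term cannot be compensated: what follows it is less than half
    of it. *)
Lemma large_expansion b m t j p : (2 < b)%N -> is_expansion b t (j :: p) ->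
  (m < `|j|)%N -> b%:Z ^+ m < `|t| *+ 2.
Proof.
move=> hb e mj; have := head_small hb e.
have := lerB_dist (k b j) t; rewrite distrC normk; last lia.
have : b%:Z ^+ m <= b%:Z ^+ (`|j|%N).-1 by apply: ler_weXn2l; lia.
have : 0 < b%:Z ^+ m by apply: exprn_gt0; lia.
lia.
Qed.

Lemma expansion_bound b m t js : (2 < b)%N -> is_expansion b t js ->
  `|t| *+ 2 < b%:Z ^+ m -> all (fun j : int => (`|j| <= m)%N) js.
Proof.
case: js => [//|j p] hb e tm /=.
have jm : (`|j| <= m)%N.
  rewrite leqNgt; apply/negP => /(large_expansion hb e) mt.
  by have := lt_trans mt tm; rewrite ltxx.
rewrite jm; have /is_expansion_cons[_ + _] := e.
by apply: sub_all => i; lia.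
Qed.

(** By the size estimates, t determines the absolute value of its leading
    place, and t is within half of the leading term, which fixes the sign;
    then the leading term is removed from both sides. *)
Lemma is_expansion_uniq b t js js' : (2 < b)%N ->
  is_expansion b t js -> is_expansion b t js' -> js = js'.
Proof.
move=> hb; elim: js js' t => [|j p IH] [|j' p'] t //.
- move=> [_ _ ->] e; have := large_expansion (m := 0) hb e.
  have /is_expansion_cons[j0 _ _] := e.
  by move=> /(_ j0); rewrite big_nil normr0 mul0rn expr0.
- move=> e [_ _ tE]; have := large_expansion (m := 0) hb e.
  have /is_expansion_cons[j0 _ _] := e.
  by move=> /(_ j0); rewrite tE big_nil normr0 mul0rn expr0.
move=> e e'.
have /is_expansion_cons[j0 pj ep] := e.
have /is_expansion_cons[j'0 pj' ep'] := e'.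
have absle i i' q q' : is_expansion b t (i :: q) -> is_expansion b t (i' :: q') ->
    (`|i| <= `|i'|)%N.
  move=> ei ei'; rewrite leqNgt; apply/negP => lti.
  have /(small_expansion hb ei') : all (fun x : int => (`|x| <= `|i'|)%N) (i' :: q').
    rewrite /= leqnn; have /is_expansion_cons[_ + _] := ei'.
    by apply: sub_all => x; lia.
  by have := large_expansion hb ei lti; lia.
have ajj' : `|j|%N = `|j'|%N.
  by apply/eqP; rewrite eqn_leq (absle _ _ _ _ e e') (absle _ _ _ _ e' e).
have kjj' : j = j'.
  have := head_small hb e; have := head_small hb e'.
  rewrite !kE -ajj'.
  have : 0 < b%:Z ^+ (`|j|%N).-1 by apply: exprn_gt0; lia.
  move: (b%:Z ^+ _) => P P0.
  have [-> //|/eqP nj] := eqVneq j j'; have jN : j' = - j by lia.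
  by rewrite jN sgzN; case: (sgzP j) => *; lia.
by rewrite -kjj' in ep' *; rewrite (IH _ _ ep ep').
Qed.

(** The canonical choice made by [expansion] can thus be replaced by any
    expansion at hand. *)
Lemma expansionE b t js : (2 < b)%N -> is_expansion b t js ->
  expansion b t = js.
Proof.
move=> hb e; apply: (is_expansion_uniq hb _ e).
exact: (@xgetPex _ [::] [set js | is_expansion b t js] (ex_intro _ js e)).
Qed.

(** * Finite sums of terms are the numbers with an expansion *)

(** Uniqueness of expansions, for expansions of length at most one. *)
Lemma k_inj b : (2 < b)%N -> injective (k b).
Proof.
move=> hb i j; case: (posnP `|i|%N) => [i0|i0]; case: (posnP `|j|%N) => [j0|j0].
- lia.
- have -> : i = 0 by lia.
  move=> /(congr1 Num.norm); rewrite k0 normr0 normk // => /esym/eqP.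
  by rewrite expf_eq0; lia.
- have -> : j = 0 by lia.
  move=> /(congr1 Num.norm); rewrite k0 normr0 normk // => /eqP.
  by rewrite expf_eq0; lia.
move=> e; suff : [:: i] = [:: j] by case.
apply: (@is_expansion_uniq b (k b i)) => //; split; rewrite /= ?i0 ?j0 //.
  by rewrite big_seq1.
by rewrite big_seq1.
Qed.

(** A finite set of values k(j) may contain both k(j) and k(-j); these cancel,
    and so does k(0) = 0. Dropping every j whose opposite also occurs leaves
    nonzero places with distinct absolute values. Since only places of A are
    kept, the same argument serves IP(k), with A all of Z, and IP_+(k), with A
    the nonnegative integers. *)
Lemma finite_sumsP b (A : set int) t : (2 < b)%N ->
  finite_sums (k b @` A) t <->
  exists2 js, is_expansion b t js & [set` js] `<=` A.
Proof.
move=> hb; split; last first.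
  move=> [js [sjs _ tE] jsA]; exists [fset x in [seq k b j | j <- js]]%fset.
    by move=> x /=; rewrite inE => /mapP[j jjs ->]; exists j => //; apply: jsA.
  have ujs : uniq js.
    apply: (sorted_uniq _ _ sjs) => [x y z|x]; first lia.
    by rewrite ltnn.
  rewrite tE -(big_map (k b) xpredT id); apply: perm_big; apply: uniq_perm.
  - by rewrite map_inj_uniq //; apply: k_inj.
  - exact: fset_uniq.
  - by move=> x; rewrite inE.
move=> [F FA ->].
have [g gP] : exists g : int -> int, {in F, forall s, A (g s) /\ k b (g s) = s}.
  exists (fun s => xget 0 [set j | A j /\ k b j = s]) => s sF.
  have [j Aj kj] := FA s sF.
  exact: (@xgetPex _ 0 [set j | A j /\ k b j = s] (ex_intro _ j (conj Aj kj))).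
set J := [seq g s | s <- F].
have kJ : [seq k b j | j <- J] = F.
  rewrite -map_comp -[RHS]map_id; apply/eq_in_map => s sF /=.
  by have [] := gP s sF.
have uJ : uniq J by apply: (@map_uniq _ _ (k b)); rewrite kJ fset_uniq.
have JA : [set` J] `<=` A.
  by move=> j /= /mapP[s sF ->]; have [] := gP s sF.
have -> : \sum_(s <- F) s = \sum_(j <- J) k b j by rewrite -kJ big_map.
pose K : seq int := [seq j : int <- J | - j \notin J].
have sumK : \sum_(j <- J) k b j = \sum_(j <- K) k b j.
  rewrite (bigID (fun j : int => - j \in J)) /= -big_filter -[X in _ + X]big_filter.
  (* L is stable under negation, so its sum equals its own opposite *)
  set L := seq.filter _ J.
  have LN : perm_eq L [seq - j | j <- L].
    apply: uniq_perm; rewrite ?(map_inj_uniq oppr_inj) ?filter_uniq // => j.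
    apply/idP/mapP => [|[i + ->]]; rewrite !mem_filter => /andP[jN jJ].
      by exists (- j); rewrite ?opprK // mem_filter opprK jN jJ.
    by rewrite opprK jN jJ.
  have : \sum_(j <- L) k b j = - \sum_(j <- L) k b j.
    rewrite {1}(perm_big _ LN) big_map -sumrN.
    by apply: eq_bigr => j _; rewrite kN.
  rewrite -/K => LNL; have -> : \sum_(j <- L) k b j = 0 by lia.
  by rewrite add0r.
have K0 : all (fun j : int => (0 < `|j|)%N) K.
  apply/allP => j; rewrite mem_filter => /andP[jN jJ]; rewrite absz_gt0.
  by apply: contraNN jN => /eqP j0; rewrite j0 oppr0 -j0.
have Kabs : {in K &, injective absz}.
  move=> i j; rewrite !mem_filter => /andP[iN iJ] /andP[jN jJ] ij.
  have [->//|ij'] := eqVneq i j.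
  have iE : i = - j by lia.
  by move: jN; rewrite -iE iJ.
exists (sort (fun i j : int => (`|j| <= `|i|)%N) K).
  split.
  - rewrite -(@sorted_map _ _ absz gtn) gtn_sorted_uniq_geq; apply/andP; split.
      rewrite map_inj_in_uniq ?sort_uniq ?filter_uniq // => i j.
      by rewrite !mem_sort; exact: Kabs.
    by rewrite sorted_map; apply: sort_sorted => i j /=; exact: leq_total.
  - by rewrite all_sort.
  - by rewrite sumK; apply/perm_big; rewrite perm_sym perm_sort.
by move=> j /=; rewrite mem_sort mem_filter => /andP[_ /JA].
Qed.

Lemma IPP b t : (2 < b)%N -> IP b t <-> exists js, is_expansion b t js.
Proof.
move=> hb; rewrite /IP finite_sumsP //; split=> [[js e _]|[js e]]; exists js => //.
Qed.

Lemma finite_sums_IP b (A : set int) t : finite_sums (k b @` A) t -> IP b t.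
Proof. by move=> [F FA tE]; exists F => // x /FA[j _ <-]; exists j. Qed.

(** * Adding a small number to a number with only large places *)

Lemma dvd_expansion b m t js : is_expansion b t js ->
  all (fun j : int => (m < `|j|)%N) js -> (b%:Z ^+ m %| t)%Z.
Proof.
move=> [_ _ ->] /allP mjs; rewrite big_seq; apply: rpred_sum => j /mjs mj.
rewrite kE -(subnKC (n := (`|j|%N).-1) (m := m)) ?exprD; last by lia.
by apply: dvdz_mull; apply: dvdz_mulr; exact: dvdzz.
Qed.

(** The small size of s keeps its places at most m, so that they come after
    all those of t. *)
Lemma expansion_add b m t s jt js : (2 < b)%N ->
  is_expansion b t jt -> all (fun j : int => (m < `|j|)%N) jt ->
  is_expansion b s js -> `|s| *+ 2 < b%:Z ^+ m ->
  is_expansion b (s + t) (jt ++ js).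
Proof.
move=> hb [sjt jt0 tE] mjt es sm.
have /allP jsm := expansion_bound hb es sm.
have [sjs js0 sE] := es.
split; last 2 first.
- by rewrite all_cat jt0 js0.
- by rewrite big_cat /= -sE -tE addrC.
move: sjt sjs; rewrite !(sorted_pairwise absgt_trans) pairwise_cat => -> ->.
rewrite !andbT; apply/allrelP => i j /(allP mjt) mi /jsm.
by rewrite /absgt; lia.
Qed.

(** The part of s + t at places at most m is congruent to s modulo b^m, and
    both are less than b^m / 2 in absolute value: hence they are equal. In
    particular s has an expansion as soon as s + t has one. *)
Lemma expansion_split b m t s js : (2 < b)%N ->
  (b%:Z ^+ m %| t)%Z -> `|s| *+ 2 < b%:Z ^+ m -> is_expansion b (s + t) js ->
  is_expansion b s [seq j <- js | (`|j| <= m)%N].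
Proof.
move=> hb dt sm est; have [_ _ stE] := est.
set lo := seq.filter _ js; set hi := [seq j <- js | ~~ (`|j| <= m)%N].
have elo := is_expansion_filter (fun j : int => `|j| <= m)%N est.
have ehi := is_expansion_filter (fun j : int => ~~ (`|j| <= m))%N est.
have dhi : (b%:Z ^+ m %| \sum_(j <- hi) k b j)%Z.
  apply: (dvd_expansion ehi); apply/allP => j; rewrite mem_filter; lia.
have lom : `|\sum_(j <- lo) k b j| *+ 2 < b%:Z ^+ m.
  by apply: (small_expansion hb elo); exact: filter_all.
suff -> : s = \sum_(j <- lo) k b j by [].
have sumE : s + t = \sum_(j <- lo) k b j + \sum_(j <- hi) k b j.
  rewrite stE (bigID (fun j : int => `|j| <= m)%N) /= -big_filter.
  by rewrite -[X in _ + X]big_filter.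
move: lom dhi sumE; clear elo ehi.
set x := \sum_(j <- lo) _; set y := \sum_(j <- hi) _ => xm dy sxy.
have : (b%:Z ^+ m %| s - x)%Z.
  have -> : s - x = y - t by lia.
  by rewrite rpredB.
have := ler_normB s x => nsx /dvdzP[q qE].
have P0 : 0 < b%:Z ^+ m by apply: exprn_gt0; lia.
have [q0|q0] := eqVneq q 0; first by move: qE; rewrite q0 mul0r; lia.
have : b%:Z ^+ m <= `|s - x|.
  by rewrite qE normrM (gtr0_norm P0) ler_peMl; lia.
by lia.
Qed.

Lemma finite_sums_add b (A : set int) m t s : (2 < b)%N ->
  finite_sums (k b @` A) t ->
  all (fun j : int => (m < `|j|)%N) (expansion b t) ->
  `|s| *+ 2 < b%:Z ^+ m ->
  finite_sums (k b @` A) (s + t) <-> finite_sums (k b @` A) s.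
Proof.
move=> hb /finite_sumsP[//|jt et jtA]; rewrite (expansionE hb et) => mt sm.
rewrite !finite_sumsP //; split=> [] [js es jsA].
  have := expansion_split hb (dvd_expansion et mt) sm es.
  set lo := seq.filter _ _; exists lo => //.
  by move=> j /=; rewrite mem_filter => /andP[_ /jsA].
exists (jt ++ js); first exact: (expansion_add hb et mt es sm).
by move=> j /=; rewrite mem_cat => /orP[/jtA|/jsA].
Qed.

(** Concatenation of expansions adds length vectors. *)
Lemma length_vectorD b D m t s : (2 < b)%N -> IP b t -> IP b s ->
  all (fun j : int => (m < `|j|)%N) (expansion b t) ->
  `|s| *+ 2 < b%:Z ^+ m ->
  length_vector b D (s + t) = vadd (length_vector b D s) (length_vector b D t).
Proof.
move=> hb /IPP[//|jt et] /IPP[//|js es]; rewrite (expansionE hb et) => mt sm.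
apply/funext => l; rewrite /vadd /length_vector.
rewrite (expansionE hb et) (expansionE hb es).
by rewrite (expansionE hb (expansion_add hb et mt es sm)) count_cat addnC.
Qed.

(** * Agreement of the two points near the origin *)

(** With 2|s| < b^m and all places of t beyond m, s + t is a sum of terms
    exactly when s is, and then r(s + t) = r(s) + r(t); so membership of
    r(s + t) in M is membership of r(s) in M - r(t). The bound on s depends on
    m alone, whence the uniformity in M. *)
Lemma shift_agree b D (A : set int) m M t s : (2 < b)%N -> label M ->
  finite_sums (k b @` A) t ->
  all (fun j : int => (m < `|j|)%N) (expansion b t) ->
  `|s| *+ 2 < b%:Z ^+ m ->
  (finite_sums (k b @` A) (s + t) /\ M (length_vector b D (s + t))) <->
  (finite_sums (k b @` A) s /\
     label_sub M (length_vector b D t) (length_vector b D s)).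
Proof.
move=> hb [MF Mle] At mt sm.
rewrite (finite_sums_add hb At mt sm).
split=> - [As]; have IPs := finite_sums_IP As;
  rewrite /label_sub /= (length_vectorD D hb (finite_sums_IP At) IPs mt sm).
  move=> Mst; split=> //; split=> //.
  (* r(s) has finite support because r(s) + r(t), being in M, has *)
  apply: sub_finite_set (MF _ Mst) => l /=.
  by rewrite /vadd; lia.
by move=> [_ Mst].
Qed.

(** The last place is the smallest one; for t = 0 there are no places at
    all. *)
Lemma nstar_large (R : realType) b t m : (2 < b)%N -> IP b t ->
  ((m.+1)%:R%:E <= nstar R b t)%E ->
  all (fun j : int => (m < `|j|)%N) (expansion b t).
Proof.
move=> hb /IPP[//|js et]; rewrite /nstar (expansionE hb et).
case/lastP: js et => [//|js j] et.
case: eqP => [t0|_].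
  have e0 : is_expansion b 0 [::] by split=> //; rewrite big_nil.
  by rewrite t0 in et; rewrite (is_expansion_uniq hb et e0).
rewrite last_rcons lee_fin ler_nat => mj.
have [+ _ _] := et; rewrite (sorted_pairwise absgt_trans) -cats1 pairwise_cat.
move=> /and3P[/allrelP gtj _ _]; rewrite cats1 all_rcons mj /=.
by apply/allP => i ijs; have := gtj i j ijs (mem_head _ _); rewrite /absgt; lia.
Qed.

(** * Shifts, the metric and convergence along the net *)

Lemma bshiftzE n u s : bshiftz n u s = u (s + n).
Proof.
have iterE p s' : iter p bshift u s' = u (s' + p%:Z).
  elim: p s' => [|p IH] s'; first by rewrite addr0.
  by rewrite iterS {1}/bshift IH; congr u; lia.
have iterVE p s' : iter p bshift_inv u s' = u (s' - p%:Z).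
  elim: p s' => [|p IH] s'; first by rewrite subr0.
  by rewrite iterS {1}/bshift_inv IH; congr u; lia.
case: n => p; first exact: iterE.
by rewrite /bshiftz iterVE NegzE.
Qed.

Lemma bdist_le (R : realType) N (u v : int -> bool) :
  (forall s : int, (`|s| < N)%N -> u s = v s) -> 0 <= bdist R u v <= 2 ^- N.
Proof.
move=> uv; apply/andP; split.
  apply: lb_le_inf; first by exists (2 ^- N), N.
  by move=> _ [n _ <-]; rewrite invr_ge0 exprn_ge0.
apply: ge_inf; last by exists N.
by exists 0 => _ [n _ <-]; rewrite invr_ge0 exprn_ge0.
Qed.

Lemma tails_filter (I : Type) (le : I -> I -> Prop) :
  directed_preorder le -> Filter (tails le).
Proof.
move=> [[i0] _ letr dir]; apply: filter_from_filter; first by exists i0.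
move=> i j _ _; have [l [il jl]] := dir i j; exists l => // x /= lx.
by split; [exact: letr il lx|exact: letr jl lx].
Qed.

Lemma label_set0 : label set0.
Proof. by split=> [m []|m1 m _ _ []]. Qed.

(** Both halves of the theorem are instances: A = Z for x[M], and A the
    nonnegative integers for x_+[M]. As soon as all places of t_i exceed m,
    every M gives distance at most 2^-N, so the supremum, taken over a nonempty
    set of numbers in [0, 2^-N], is in that interval as well. *)
Lemma sup_bdist_cvg0 (R : realType) b D (A : set int) (I : Type) (F : set_system I)
    (x : set (posnat -> nat) -> int -> bool) (t : I -> int) :
  Filter F -> (2 < b)%N ->
  (forall M s, x M s <-> finite_sums (k b @` A) s /\ M (length_vector b D s)) ->
  (forall i, finite_sums (k b @` A) (t i)) ->
  nstar R b (t i) @[i --> F] --> +oo%E ->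
  sup [set bdist R (bshiftz (t i) (x M))
                   (x (label_sub M (length_vector b D (t i))))
       | M in LAB] @[i --> F] --> (0 : R).
Proof.
move=> FF hb xP At tlim; apply/cvgrPdist_le => e e0.
have [N eN] : exists N, (2 : R) ^- N <= e.
  have [N _ /(_ N (leqnn _)) /= eN] := near_infty_natSinv_expn_lt (PosNum e0).
  by exists N; rewrite -div1r ltW.
(* |s| < N then gives 2|s| < m < b^m *)
pose m := N.*2.
have /cvgeyPge /(_ (m.+1)%:R) := tlim; apply: filterS => i tlarge.
have mt := nstar_large hb (finite_sums_IP (At i)) tlarge.
have dist M : LAB M -> 0 <= bdist R (bshiftz (t i) (x M))
    (x (label_sub M (length_vector b D (t i)))) <= 2 ^- N.
  move=> labM; apply: bdist_le => s sN; rewrite bshiftzE.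
  have sm : `|s| *+ 2 < b%:Z ^+ m.
    have bm : (m < b ^ m)%N by apply: ltn_expl; lia.
    have -> : b%:Z ^+ m = (b ^ m)%:Z by rewrite -!natz natrX.
    by lia.
  by apply/idP/idP; rewrite !xP (shift_agree D hb labM (At i) mt sm).
set E := [set _ | _ in _].
set d0 := bdist R (bshiftz (t i) (x set0))
  (x (label_sub set0 (length_vector b D (t i)))).
have Ed0 : E d0 by exists set0 => //; exact: label_set0.
have Ele : ubound E e.
  by move=> _ [M labM <-]; have /andP[_ /le_trans] := dist M labM; apply.
rewrite sub0r normrN ger0_norm.
  by apply: ge_sup => //; exists d0.
have /andP[d0_ge0 _] := dist _ label_set0.
by apply: (le_trans d0_ge0); apply: ub_le_sup => //; exists e.
Qed.

Theorem lemma3p20 (R : realType) (b : nat) (hb_odd : odd b) (hb5 : (5 <= b)%N)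
    (D : posnat -> set nat) (hD : admissible_partition D)
    (I : Type) (le : I -> I -> Prop) (hI : directed_preorder le)
    (t : I -> int) (ht : forall i, IP b (t i))
    (hlim : nstar R b (t i) @[i --> tails le] --> +oo%E) :
  (sup [set bdist R (bshiftz (t i) (x_ b D M))
                   (x_ b D (label_sub M (length_vector b D (t i))))
       | M in LAB] @[i --> tails le] --> (0 : R)) /\
  ((forall i, IP_plus b (t i)) ->
   sup [set bdist R (bshiftz (t i) (x_plus b D M))
                   (x_plus b D (label_sub M (length_vector b D (t i))))
       | M in LAB] @[i --> tails le] --> (0 : R)).
Proof.
have FF := tails_filter hI; have hb : (2 < b)%N by lia.
split=> [|tplus].
  by apply: (sup_bdist_cvg0 (A := setT)) => // M s; rewrite asboolE.
apply: (sup_bdist_cvg0 (A := [set j : int | 0 <= j])) => // M s.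
rewrite asboolE; split=> [[[_ Ms]]|[As Ms]] //.
by do !split=> //; exact: finite_sums_IP As.
Qed.
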